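(* Let $A$ be a finite-dimensional derivation algebra over a field $\mathbb{F}$ of characteristic zero whose associated Lie algebra $\mathcal{G}_A$ is nonsingular nilpotent. Then $A$ is complete.
   Context: A left-symmetric algebra over $\mathbb{F}$ is a vector space $A$ over $\mathbb{F}$ with a bilinear product $\cdot$ such that $(x\cdot y)\cdot z-x\cdot(y\cdot z)=(y\cdot x)\cdot z-y\cdot(x\cdot z)$ for all $x,y,z\in A$. Its associated Lie algebra $\mathcal{G}_A$ is $A$ with bracket $[x,y]=x\cdot y-y\cdot x$. A derivation algebra is a left-symmetric algebra satisfying $(x\cdot y)\cdot z=(z\cdot y)\cdot x$ for all $x,y,z\in A$. $A$ is complete if the right multiplication $R_x:y\mapsto y\cdot x$ is nilpotent for every $x\in A$. For a Lie algebra $\mathcal{G}$ put $\mathcal{C}^0\mathcal{G}=\mathcal{G}$ and $\mathcal{C}^i\mathcal{G}=[\mathcal{G},\mathcal{C}^{i-1}\mathcal{G}]$ for $i\geq 1$. $\mathcal{G}$ is nonsingular nilpotent if there is an integer $m\geq 1$ such that $\mathcal{C}^m\mathcal{G}\neq\{0\}$, $\mathcal{C}^{m+1}\mathcal{G}=\{0\}$ and the center of $\mathcal{G}$ equals $\mathcal{C}^m\mathcal{G}$ (in particular $\mathcal{G}$ is non-abelian). *)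

(* Defs.v *)
From HB Require Import structures.
From mathcomp Require Import all_boot all_order all_algebra.

Set Implicit Arguments.
Unset Strict Implicit.
Unset Printing Implicit Defensive.

Import GRing.Theory.
Local Open Scope ring_scope.

Section LeftSymmetric.
Variables (F : fieldType) (A : vectType F).
Implicit Types (mul br : A -> A -> A) (U V W : {vspace A}).

Definition left_symmetric mul :=
  forall x y z : A,
    mul (mul x y) z - mul x (mul y z) = mul (mul y x) z - mul y (mul x z).

Definition derivation_algebra mul :=
  left_symmetric mul /\ forall x y z : A, mul (mul x y) z = mul (mul z y) x.

Definition complete mul :=
  forall x : A, exists n : nat, forall y : A, iter n (fun t => mul t x) y = 0.

Definition commutator mul (x y : A) : A := mul x y - mul y x.

(* The span of all [x, y] with x in U and y in V.  As for prodv in falgebra,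
   the span is taken over brackets of basis vectors; lie_prodv_sub shows that
   for a bilinear bracket this is the least subspace containing all brackets. *)
Definition lie_prodv br U V : {vspace A} :=
  <<[seq br x y | x <- vbasis U, y <- vbasis V]>>%VS.

Fixpoint lower_central br (i : nat) : {vspace A} :=
  if i is j.+1 then lie_prodv br fullv (lower_central br j) else fullv.

Definition lie_central br (z : A) := forall x : A, br z x = 0.

Definition nonsingular_nilpotent br :=
  exists m : nat, [/\ (1 <= m)%N,
    lower_central br m != 0%VS,
    lower_central br m.+1 = 0%VS
    & forall z : A, lie_central br z <-> z \in lower_central br m].

Lemma commutator_bilinear (mul : {bilinear A -> A -> A}) :
  bilinear_for *:%R *:%R (commutator mul).
Proof.
split=> z a x y; rewrite /commutator /= linearPl linearPr scalerBr opprD.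
  by rewrite addrACA.
by rewrite addrACA.
Qed.

HB.instance Definition _ (mul : {bilinear A -> A -> A}) :=
  bilinear_isBilinear.Build F A A A *:%R *:%R (commutator mul)
    (commutator_bilinear mul).

Lemma lie_prodv_sub (br : {bilinear A -> A -> A}) U V W :
  (lie_prodv br U V <= W)%VS <-> {in U & V, forall x y, br x y \in W}.
Proof.
split=> [/subvP sUVW x y Ux Vy|UVW]; last first.
  apply/span_subvP => _ /allpairsP[[x y] [/= Ux Vy ->]].
  by apply: UVW; apply: vbasis_mem.
apply: sUVW; rewrite (coord_vbasis Ux) (coord_vbasis Vy) linear_sumr memv_suml //.
move=> j _; rewrite linearZr_LR linear_sumlz memvZ // memv_suml // => i _.
rewrite linearZl_LR memvZ // memv_span //; apply/allpairsP.
by exists ((vbasis U)`_i, (vbasis V)`_j); rewrite !mem_nth ?size_tuple.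
Qed.

Lemma commutatorxx mul x : commutator mul x x = 0.
Proof. exact: subrr. Qed.

Lemma commutator_jacobi (mul : {bilinear A -> A -> A}) x y z :
  left_symmetric mul ->
  let br := commutator mul in
  br x (br y z) + br y (br z x) + br z (br x y) = 0.
Proof.
move=> lsa /=; rewrite /commutator !linearBr !linearBl.
rewrite !opprB [LHS](AC ((2*2)*(2*2)*(2*2))
  (((11*6)*(1*12))*((3*10)*(5*4))*((7*2)*(9*8)))).
rewrite /= -(lsa x y z) -(lsa y z x) -(lsa z x y).
by rewrite !subrKA !subrr !addr0.
Qed.

End LeftSymmetric.

(* Main.v *)
(* Write L, R for the left and right multiplications.  All L_x are derivations
   of the Lie algebra, and on the graded space of its lower central series
   R_x = L_x and L_(xy) = L_x L_y.

   Let P, a polynomial without constant term in R_a, be the projection onto the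
   Fitting component where R_a is invertible.  Then P is congruent to L_e for
   some e, so tr L_e = rank P and L_e has only the generalized eigenvalues 0
   and 1.  In the grading A = E0 + E1 of the derivation L_e one has
   [E0, E1] <= E1 and [E1, E1] = 0 (2 is not an eigenvalue), hence E1 E0 = 0.
   The identity (xy)z = (zy)x then gives E1 (E0 E1) = 0, so for e = e0 + e1
   the map L_e acts on E0 E1 as ad e0, nilpotently; hence E0 E1 = 0 and E1 is
   central.  By nonsingularity e1 is in [A, A], so tr L_e1 = 0, while L_e0 is
   nilpotent.  Thus rank P = tr L_e = 0, which means that R_a is nilpotent. *)
From HB Require Import structures.
Require Import Defs.
From mathcomp Require Import all_boot all_order all_algebra.
From mathcomp Require Import ring.

Set Implicit Arguments.
Unset Strict Implicit.
Unset Printing Implicit Defensive.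

Import GRing.Theory VectorInternalTheory.
Local Open Scope ring_scope.

(** * Traces of idempotent and nilpotent matrices, and the Fitting projection *)

Lemma mxtrace_idempotent (F : fieldType) n (P : 'M[F]_n) :
  P *m P = P -> \tr P = (\rank P)%:R.
Proof.
(* With P = [col_base P *m row_base P], the outer factors of P P = P cancel. *)
move=> PP; have RC1 : row_base P *m col_base P = 1%:M.
  apply: (row_full_inj (col_base_full P)); apply: (row_free_inj (row_base_free P)).
  by rewrite mulmx1 (mulmxA (col_base P)) -(mulmxA _ (col_base P)) mulmx_base.
by rewrite -{1}(mulmx_base P) mxtrace_mulC RC1 mxtrace1.
Qed.

(** X - M divides X^k - M^k = X^k, so by determinants [char_poly M] divides a power of X and hence
    is one; the trace is minus its subleading coefficient. *)
Lemma mxtrace_nilpotent (F : fieldType) n (M : 'M[F]_n) k :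
  M ^+ k = 0 -> \tr M = 0.
Proof.
case: n M => [|n] M Mk0; first by rewrite /mxtrace big_ord0.
have dvd_chi : char_poly M %| ('X - 0%:P) ^+ (k * n.+1).
  rewrite subr0 exprM -det_scalar rmorphXn /=.
  have /(congr1 (map_mx polyC)) := Mk0; rewrite rmorphXn /= raddf0 => Mk0'.
  rewrite -[_ ^+ k]subr0 -Mk0' subrXX_comm; last exact: comm_scalar_mx.
  by rewrite det_mulmx dvdp_mulIl.
have /dvdp_exp_XsubCP[j _] := dvd_chi.
rewrite eqp_monic ?char_poly_monic ?monic_exp ?monicXsubC // subr0 => /eqP chiE.
have := size_char_poly M; rewrite chiE size_polyXn => -[jE].
apply: oppr_inj; rewrite -char_poly_trace // chiE jE coefXn oppr0.
by rewrite (ltn_eqF (ltnSn n)).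
Qed.

Lemma fitting_idempotent (F : fieldType) n (M : 'M[F]_n) :
  exists (k : nat) (c : nat -> F),
    let P := \sum_(i < k) c i *: M ^+ i.+1 in
    P *m P = P /\ (P = 0 -> exists j, M ^+ j = 0).
Proof.
case: n M => [|n] M.
  exists 0%N, (fun=> 0) => /=; split=> [|_]; last exists 0%N.
    by apply/matrixP=> -[].
  by apply/matrixP=> -[].
have [k [q]] := multiplicity_XsubC (char_poly M) 0.
rewrite monic_neq0 ?char_poly_monic //= subr0 => q0 chiE.
(* The exponent [k.+1] makes [g] divisible by X even when k = 0, so that P has no constant term;
   [g * (g - 1)] is a multiple of the characteristic polynomial. *)
have /Bezout_eq1_coprimepP[[u v] /= uv1] : coprimep ('X ^+ k.+1) q.
  by rewrite coprimep_expl // coprimep_sym -['X]subr0 coprimep_XsubC.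
pose g := u * 'X ^+ k.+1.
have gE : horner_mx M g = \sum_(i < size (u * 'X^k)) (u * 'X^k)`_i *: M ^+ i.+1.
  rewrite /g exprSr mulrA -[in LHS](coefK (u * 'X^k)) poly_def mulr_suml.
  rewrite rmorph_sum; apply: eq_bigr => i _ /=.
  by rewrite -scalerAl -exprSr linearZ /= rmorphXn /= horner_mx_X.
have chi0 := Cayley_Hamilton M; rewrite chiE in chi0.
exists (size (u * 'X^k)), (fun i => (u * 'X^k)`_i); rewrite /= -gE; split=> [|g0].
  apply/eqP; rewrite -subr_eq0 -{3}[horner_mx M g]mul1r.
  rewrite -[_ *m _]/(_ * _) -mulrBl.
  have -> : horner_mx M g - 1 = horner_mx M (- (v * q)).
    by rewrite -(rmorph1 (horner_mx M)) -rmorphB /= -uv1 opprD addNKr.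
  rewrite -rmorphM /=.
  have -> : - (v * q) * g = (- v * u * 'X) * (q * 'X^k).
    by rewrite /g exprS; ring.
  by rewrite rmorphM /= chi0 mulr0.
exists k; rewrite -[M in LHS]horner_mx_X -rmorphXn /= -['X^k]mul1r -uv1.
rewrite mulrDl rmorphD rmorphM /= g0 mul0r add0r.
by rewrite -mulrA rmorphM /= chi0 mulr0.
Qed.

(** * Endomorphisms: traces and generalized eigenvectors *)

Section Endomorphisms.
Variables (F : fieldType) (A : vectType F).
Implicit Types (f g h : 'End(A)) (u v w : A) (a b : F).

Lemma iter_lfunD f k u v : iter k f (u + v) = iter k f u + iter k f v.
Proof. by elim: k => //= k ->; rewrite linearD. Qed.

Lemma iter_lfunZ f k a u : iter k f (a *: u) = a *: iter k f u.
Proof. by elim: k => //= k ->; rewrite linearZ. Qed.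

Lemma iter_lfun0 f k : iter k f 0 = 0.
Proof. by elim: k => //= k ->; rewrite linear0. Qed.

Lemma iter_lfun_le f j k v : (j <= k)%N -> iter j f v = 0 -> iter k f v = 0.
Proof. by move=> /subnK <- fv0; rewrite iterD fv0 iter_lfun0. Qed.

Lemma iter_comp_comm f g k v : (forall u, f (g u) = g (f u)) ->
  iter k f (iter k g v) = iter k (f \o g)%VF v.
Proof.
move=> fgC; have iterC n u : iter n f (g u) = g (iter n f u).
  by elim: n => //= n ->.
by elim: k => //= k IHk; rewrite comp_lfunE -IHk iterC.
Qed.

Definition lftrace f := \tr (f2mx f).

Lemma v2r_lfun f v : v2r (f v) = v2r v *m f2mx f.
Proof. by rewrite unlock /= r2vK. Qed.

Lemma v2r_iter f k v : v2r (iter k f v) = v2r v *m f2mx f ^+ k.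
Proof.
elim: k => [|k IHk]; first by rewrite expr0 mulmx1.
by rewrite iterS v2r_lfun IHk exprSr mulmxA.
Qed.

Lemma f2mx_eq f M : (forall v, v2r (f v) = v2r v *m M) -> f2mx f = M.
Proof.
move=> fM; apply/row_matrixP => i; rewrite !rowE -(r2vK (delta_mx 0 i)).
by rewrite -v2r_lfun fM.
Qed.

Lemma lftraceD f g : lftrace (f + g) = lftrace f + lftrace g.
Proof.
rewrite /lftrace -mxtraceD; congr (\tr _); apply: f2mx_eq => v.
by rewrite add_lfunE linearD /= !v2r_lfun mulmxDr.
Qed.

Lemma lftraceZ a f : lftrace (a *: f) = a * lftrace f.
Proof.
rewrite /lftrace -mxtraceZ; congr (\tr _); apply: f2mx_eq => v.
by rewrite scale_lfunE linearZ /= v2r_lfun scalemxAr.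
Qed.

Lemma lftrace_comp f g : lftrace (f \o g)%VF = \tr (f2mx g *m f2mx f).
Proof.
congr (\tr _); apply: f2mx_eq => v.
by rewrite comp_lfunE !v2r_lfun mulmxA.
Qed.

Lemma lftrace_compC f g : lftrace (f \o g)%VF = lftrace (g \o f)%VF.
Proof. by rewrite !lftrace_comp mxtrace_mulC. Qed.

Lemma lftrace_nilpotent f k : (forall v, iter k f v = 0) -> lftrace f = 0.
Proof.
move=> fk0; apply: (@mxtrace_nilpotent _ _ _ k); apply/row_matrixP => i.
by rewrite rowE -(r2vK (delta_mx 0 i)) -v2r_iter fk0 linear0 row0.
Qed.

Lemma lfun_fitting_idempotent f : exists (k : nat) (c : nat -> F) (P : 'End(A)),
  [/\ forall v, P v = \sum_(i < k) c i *: iter i.+1 f v,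
      forall v, P (P v) = P v
    & exists r : nat, lftrace P = r%:R /\
        (r = 0%N -> exists j, forall v, iter j f v = 0)].
Proof.
have [k [c [/=]]] := fitting_idempotent (f2mx f).
set M := \sum_(i < k) _ => MM Mnil.
have HomE v : v2r (Hom M v) = v2r v *m M by rewrite v2r_lfun.
exists k, c, (Hom M); split=> [v|v|].
- apply: v2r_inj; rewrite HomE /M mulmx_sumr linear_sum; apply: eq_bigr => i _.
  by rewrite -scalemxAr -v2r_iter linearZ.
- by apply: v2r_inj; rewrite !HomE -mulmxA MM.
exists (\rank M); split; first exact: mxtrace_idempotent.
move=> /eqP; rewrite mxrank_eq0 => /eqP /Mnil[j Mj0]; exists j => v.
by apply: v2r_inj; rewrite v2r_iter Mj0 mulmx0 linear0.
Qed.

(** The order [k] is explicit because the main proofs below are inductions on a sum of two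
    orders. *)
Definition gen_eigen f a k v := iter k (f - a *: \1)%VF v = 0.

Lemma shiftE f a v : (f - a *: \1)%VF v = f v - a *: v.
Proof. by rewrite !lfun_simp. Qed.

Lemma gen_eigenP f a k v :
  gen_eigen f a k.+1 v <-> gen_eigen f a k (f v - a *: v).
Proof. by rewrite /gen_eigen iterSr shiftE. Qed.

Lemma gen_eigenD f a k u v :
  gen_eigen f a k u -> gen_eigen f a k v -> gen_eigen f a k (u + v).
Proof. by rewrite /gen_eigen iter_lfunD => -> ->; rewrite addr0. Qed.

Lemma gen_eigenZ f a k b v : gen_eigen f a k v -> gen_eigen f a k (b *: v).
Proof. by rewrite /gen_eigen iter_lfunZ => ->; rewrite scaler0. Qed.

Lemma gen_eigenB f a k u v :
  gen_eigen f a k u -> gen_eigen f a k v -> gen_eigen f a k (u - v).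
Proof. by move=> fu fv; rewrite -scaleN1r; apply/gen_eigenD/gen_eigenZ. Qed.

Lemma gen_eigen_le f a j k v :
  (j <= k)%N -> gen_eigen f a j v -> gen_eigen f a k v.
Proof. exact: iter_lfun_le. Qed.

Lemma gen_eigen_shift f a k b v :
  gen_eigen f a k v -> gen_eigen f a k (f v - b *: v).
Proof.
move=> fv; have -> : f v - b *: v = (f v - a *: v) + (a - b) *: v.
  by rewrite scalerBl addrA addrNK.
apply: gen_eigenD (gen_eigenZ _ fv); apply/gen_eigenP.
exact: gen_eigen_le (leqnSn k) fv.
Qed.

(* Both shifts of f lower the order of a vector, so that this decomposition
   drives inductions on the sum of the orders for a and for b. *)
Lemma shift_decomp f a b v : b - a != 0 ->
  v = (b - a)^-1 *: (f v - a *: v) - (b - a)^-1 *: (f v - b *: v).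
Proof.
move=> ba0; rewrite -scalerBr opprB [f v - _ + _]addrC subrKA -scalerBl.
by rewrite scalerA mulVf // scale1r.
Qed.

Lemma gen_eigen_disjoint f a b j k v : a != b ->
  gen_eigen f a j v -> gen_eigen f b k v -> v = 0.
Proof.
move=> neq_ab; have ba0 : b - a != 0 by rewrite subr_eq0 eq_sym.
have [n] := ubnP (j + k); elim: n j k v => // n IHn [|j] [|k] v //.
rewrite addSn addnS !ltnS => le_jk_n fav fbv; rewrite (shift_decomp f v ba0).
have -> : f v - a *: v = 0.
  apply: (IHn j k.+1); rewrite ?addnS //; first exact/gen_eigenP.
  exact: gen_eigen_shift.
have -> : f v - b *: v = 0.
  apply: (IHn j.+1 k); rewrite ?addSn //; last exact/gen_eigenP.
  exact: gen_eigen_shift.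
by rewrite !scaler0 subr0.
Qed.

(** Primary decomposition for (X - a)^j (X - b)^k, one vector at a time: the induction splits (f -
    a) v and (f - b) v, which combine to v. *)
Lemma gen_eigen_split f a b j k v : a != b ->
  gen_eigen f a j (iter k (f - b *: \1)%VF v) ->
  exists u w, [/\ v = u + w, gen_eigen f a j u & gen_eigen f b k w].
Proof.
move=> neq_ab; have ba0 : b - a != 0 by rewrite subr_eq0 eq_sym.
have shiftC m u : f (iter m (f - b *: \1)%VF u) - a *: iter m (f - b *: \1)%VF u
    = iter m (f - b *: \1)%VF (f u - a *: u).
  elim: m => //= m IHm; rewrite -IHm !shiftE; set w := iter _ _ _.
  rewrite !linearB !linearZ /= scalerA mulrC -scalerA !addrA.
  by rewrite (addrAC (f _)).
have [n] := ubnP (j + k); elim: n j k v => // n IHn [|j] [|k] v.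
- by move=> _ v0; exists 0, 0; rewrite addr0; split => //; apply: iter_lfun0.
- by move=> _ v0; exists 0, v; rewrite add0r.
- by move=> _ v0; exists v, 0; rewrite addr0.
rewrite addSn addnS !ltnS => le_jk_n fv.
have [|| u1 [w1 [e1 fu1 fw1]]] := IHn j k.+1 (f v - a *: v); first by rewrite ?addnS.
  by rewrite -shiftC; apply/gen_eigenP.
have [|| u2 [w2 [e2 fu2 fw2]]] := IHn j.+1 k (f v - b *: v); first by rewrite ?addSn.
  by rewrite -shiftE -iterSr.
exists ((b - a)^-1 *: u1 - (b - a)^-1 *: u2), ((b - a)^-1 *: w1 - (b - a)^-1 *: w2).
split.
- by rewrite {1}(shift_decomp f v ba0) e1 e2 !scalerDr opprD addrACA.
- by apply: gen_eigenB; apply: gen_eigenZ => //; apply: gen_eigen_le fu1.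
by apply: gen_eigenB; apply: gen_eigenZ => //; apply: gen_eigen_le fw2.
Qed.

(** (h - a - b) B(u, v) = B((f - a) u, v) + B(u, (g - b) v), where both terms have lower total
    order. Three maps are allowed since L_e acts on a product x y by [ad e] on x and by L_e on y. *)
Lemma gen_eigen_pairing (B : {bilinear A -> A -> A}) f g h a b i j u v :
  (forall u v, h (B u v) = B (f u) v + B u (g v)) ->
  gen_eigen f a i u -> gen_eigen g b j v -> gen_eigen h (a + b) (i + j) (B u v).
Proof.
move=> hB; have [n] := ubnP (i + j); elim: n i j u v => // n IHn.
case=> [|i] j u v.
  by move=> _; rewrite /gen_eigen /= => -> _; rewrite linear0l; apply: iter_lfun0.
case: j => [|j].
  move=> _ _; rewrite /gen_eigen /= => ->; rewrite linear0r.
  exact: (iter_lfun0 _ (i.+1 + 0)).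
rewrite !addSn !addnS !ltnS => le_ij_n fu gv; apply/gen_eigenP.
have -> : h (B u v) - (a + b) *: B u v = B (f u - a *: u) v + B u (g v - b *: v).
  rewrite hB linearBl linearBr linearZl_LR linearZr_LR scalerDl opprD.
  by rewrite addrACA.
apply: gen_eigenD.
  by rewrite -addnS; apply: IHn; rewrite ?addnS //; apply/gen_eigenP.
by rewrite -addSn; apply: IHn; rewrite ?addSn //; apply/gen_eigenP.
Qed.

End Endomorphisms.

(** * Derivation algebras and their lower central series *)

Section DerivationAlgebra.
Variables (F : fieldType) (A : vectType F) (mul : {bilinear A -> A -> A}).
Hypothesis derA : derivation_algebra mul.
Implicit Types (x y z u v w e : A).

Local Notation br := (commutator mul).
Local Notation C := (lower_central br).

Definition lmul x : 'End(A) := linfun (mul x).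
Definition rmul x : 'End(A) := linfun (applyr mul x).
Definition ad x : 'End(A) := lmul x - rmul x.

Lemma lmulE x y : lmul x y = mul x y. Proof. by rewrite lfunE. Qed.
Lemma rmulE x y : rmul x y = mul y x. Proof. by rewrite lfunE. Qed.
Lemma adE x y : ad x y = br x y. Proof. by rewrite !lfun_simp. Qed.

Lemma lmulD x y : lmul (x + y) = lmul x + lmul y.
Proof. by apply/lfunP => v; rewrite add_lfunE !lmulE linearDl. Qed.

Lemma lmulZ a x : lmul (a *: x) = a *: lmul x.
Proof. by apply/lfunP => v; rewrite scale_lfunE !lmulE linearZl_LR. Qed.

Lemma mulC13 x y z : mul (mul x y) z = mul (mul z y) x.
Proof. by case: derA. Qed.

(** Left symmetry, read as L_[x,y] = [L_x, L_y]. *)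
Lemma mul_leibniz x y z : mul x (mul y z) = mul (br x y) z + mul y (mul x z).
Proof.
have [lsa _] := derA.
by rewrite linearBl -[LHS](subKr (mul (mul x y) z)) lsa opprB addrA addrAC.
Qed.

(** After expansion the surplus terms (z x) y and (y x) z cancel by [mulC13]. *)
Lemma mul_derivation x y z : mul x (br y z) = br (mul x y) z + br y (mul x z).
Proof.
rewrite /commutator linearBr /= (mul_leibniz x y z) (mul_leibniz x z y) !linearBl /=.
rewrite (mulC13 z x y) !opprD !opprK.
rewrite [LHS](AC (3*3) ((1*6)*(3*4)*(2*5))).
by rewrite /= addNr addr0.
Qed.

Lemma lower_central_br i x v : v \in C i -> br x v \in C i.+1.
Proof.
move=> Cv; have /lie_prodv_sub := subvv (C i.+1); apply => //.
exact: memvf.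
Qed.

Lemma lower_central_lmul i x v : v \in C i -> mul x v \in C i.
Proof.
elim: i x v => [|i IHi] x v; first by rewrite !memvf.
suff /subvP sub : (C i.+1 <= lmul x @^-1: C i.+1)%VS.
  by move=> /sub; rewrite -memv_preim lmulE.
apply/lie_prodv_sub => y z _ Cz; rewrite -memv_preim lmulE mul_derivation.
by rewrite memvD // lower_central_br // IHi.
Qed.

Lemma lower_centralS i v : v \in C i.+1 -> v \in C i.
Proof.
elim: i v => [|i IHi] v; first by rewrite memvf.
move: v; apply/subvP/lie_prodv_sub => y z _ Cz.
exact/lower_central_br/IHi.
Qed.

Lemma lower_central_rmul i x v : v \in C i -> mul v x \in C i.
Proof.
move=> Cv; have -> : mul v x = mul x v - br x v by rewrite opprB addrC subrK.
by rewrite memvB ?lower_central_lmul // lower_centralS ?lower_central_br.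
Qed.

(* On the graded space of the filtration C, [lowers f] says that f induces 0;
   there the left and the right multiplication by x coincide, since ad x
   induces 0, and L_(xy) = L_x R_y = L_x L_y. *)
Definition lowers (f : 'End(A)) := forall i v, v \in C i -> f v \in C i.+1.

Lemma lowers_ad x : lowers (ad x).
Proof. by move=> i v; rewrite adE; apply: lower_central_br. Qed.

Lemma lowers_nilpotent f m : C m = 0%VS -> lowers f -> forall v, iter m f v = 0.
Proof.
move=> Cm0 Nf v; apply/eqP; rewrite -memv0 -Cm0.
by elim: m {Cm0} => [|m IHm]; [rewrite memvf | apply: Nf].
Qed.

Lemma lowers_lmul_rmul x y : lowers (lmul (mul x y) - (lmul x \o rmul y)%VF).
Proof.
move=> i v Cv; rewrite !lfun_simp /= mulC13.
have -> : mul (mul v y) x = br (mul v y) x + mul x (mul v y) by rewrite subrK.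
rewrite addrK -[br _ _]opprB memvN; apply: lower_central_br.
exact: lower_central_rmul.
Qed.

(** Iterating L_(xy) = L_x R_y makes every positive power of R_a congruent to a left multiplication;
    this is the source of e. *)
Lemma lowers_lmul_iter a i j v :
  v \in C j -> mul (iter i (rmul a) a) v - iter i.+1 (rmul a) v \in C j.+1.
Proof.
elim: i v => [|i IHi] v Cv; first by rewrite /= rmulE; apply: lower_central_br.
rewrite [iter i.+2 _ _]iterSr [iter i.+1 _ a]iterS !rmulE.
rewrite -(subrKA (mul (iter i (rmul a) a) (mul v a))).
rewrite memvD //; last by rewrite IHi // lower_central_rmul.
have := @lowers_lmul_rmul (iter i (rmul a) a) a j v Cv.
by rewrite !lfun_simp.
Qed.

Lemma lftrace_lmul_br x y : lftrace (lmul (br x y)) = 0.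
Proof.
have -> : lmul (br x y) = (lmul x \o lmul y)%VF + (-1) *: (lmul y \o lmul x)%VF.
  apply/lfunP => v; rewrite !lfun_simp /= scaleN1r.
  by rewrite (mul_leibniz x y v) addrK.
by rewrite lftraceD lftraceZ lftrace_compC mulN1r subrr.
Qed.

Lemma lftrace_lmul_derived z : z \in C 1 -> lftrace (lmul z) = 0.
Proof.
(* The trace as a linear form has a subspace for kernel, so it is enough to treat brackets. *)
pose t : A -> F^o := fun z => lftrace (lmul z).
have t_lin : linear t by move=> a x y; rewrite /t lmulD lmulZ lftraceD lftraceZ.
pose tL : {linear A -> F^o} := HB.pack t (GRing.isLinear.Build _ _ _ _ t t_lin).
suff /subvP sub : (C 1 <= lker (linfun tL))%VS.
  by move=> /sub; rewrite memv_ker lfunE => /eqP.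
by apply/lie_prodv_sub => x y _ _; rewrite memv_ker lfunE /= /t lftrace_lmul_br.
Qed.

Lemma lftrace_lmul_idempotent N e :
    C N = 0%VS -> (forall z, lie_central br z -> z \in C 1) -> 2%:R != 0 :> F ->
  lowers ((lmul e \o lmul e)%VF - lmul e) -> lftrace (lmul e) = 0.
Proof.
move=> CN0 centC neq20 ideme; set D := lmul e.
pose E a x := exists k, gen_eigen D a k x.
have neq01 : 0 != 1 :> F by rewrite eq_sym oner_neq0.
have neq12 : 1 != 2%:R :> F.
  by rewrite eq_sym -subr_eq0 -[2%:R]/(1 + 1) addrK oner_neq0.
(* D (D - 1) maps each term of the series into the next, and D commutes with D - 1. *)
have annih v : iter N (D - 0 *: \1)%VF (iter N (D - 1 *: \1)%VF v) = 0.
  rewrite iter_comp_comm => [|u]; last first.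
    by rewrite !shiftE !scale0r !subr0 !scale1r linearB.
  apply: lowers_nilpotent => // i u Cu.
  have := ideme i u Cu; rewrite !lfun_simp.
  by rewrite scale0r subr0 scale1r linearB.
have decomp v : exists u w,
    [/\ v = u + w, gen_eigen D 0 N u & gen_eigen D 1 N w].
  exact/gen_eigen_split/annih.
have disj v : E 0 v -> E 1 v -> v = 0.
  by move=> [i v0] [j v1]; apply: gen_eigen_disjoint neq01 v0 v1.
have ad_nil x u : iter N (ad x) u = 0 by exact/lowers_nilpotent/lowers_ad.
(* L_e (x y) = [e, x] y + x (L_e y), and every x has eigenvalue 0 for the nilpotent [ad e]. *)
have E_mul a x y : E a y -> E a (mul x y).
  move=> [k ay]; exists (N + k)%N; rewrite -[a]add0r.
  apply: (@gen_eigen_pairing _ _ mul (ad e)) ay => [u v|].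
    by rewrite !lmulE adE mul_leibniz.
  by rewrite /gen_eigen scale0r subr0.
have E_br a b x y : E a x -> E b y -> E (a + b) (br x y).
  move=> [i ax] [j b_y]; exists (i + j)%N.
  apply: (@gen_eigen_pairing _ _ br D D) ax b_y => u v.
  by rewrite !lmulE mul_derivation.
(* [x, y] has eigenvalue 2, but L_e has only the eigenvalues 0 and 1. *)
have br11 x y : E 1 x -> E 1 y -> br x y = 0.
  move=> x1 y1; have [k v2] := E_br _ _ _ _ x1 y1.
  rewrite -[1 + 1]/2%:R in v2.
  have v2' n : gen_eigen D 2%:R k (iter n (D - 1 *: \1)%VF (br x y)).
    by elim: n => //= n IHn; rewrite shiftE; apply: gen_eigen_shift.
  apply: gen_eigen_disjoint neq12 _ v2.
  apply: gen_eigen_disjoint (v2' N); last exact: annih.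
  by rewrite eq_sym; exact: neq20.
(* y x is in [E 0] because x is, and in [E 1] as x y - [x, y]. *)
have mul10 x y : E 0 x -> E 1 y -> mul y x = 0.
  move=> x0 y1; apply: disj; first exact: E_mul.
  have -> : mul y x = mul x y - br x y by rewrite opprB addrC subrK.
  have [i xy1] := E_mul _ x _ y1; have := E_br _ _ _ _ x0 y1.
  rewrite add0r => -[j bxy1]; exists (maxn i j).
  apply: gen_eigenB; [apply: gen_eigen_le xy1 | apply: gen_eigen_le bxy1].
    exact: leq_maxl.
  exact: leq_maxr.
(* z commutes with x y, so z (x y) = (x y) z = (z y) x, which [mul10] kills. *)
have mul101 x y z : E 0 x -> E 1 y -> E 1 z -> mul z (mul x y) = 0.
  move=> x0 y1 z1; have := br11 _ _ z1 (E_mul _ x _ y1).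
  move/eqP; rewrite subr_eq0 => /eqP->; rewrite mulC13.
  by apply: mul10 => //; apply: E_mul.
have [e0 [e1 [eE e00 e11]]] := decomp e.
have {}e00 : E 0 e0 by exists N.
have {}e11 : E 1 e1 by exists N.
have DE v : D v = mul e0 v + mul e1 v by rewrite lmulE [in LHS]eE linearDl.
have mul01 x y : E 0 x -> E 1 y -> mul x y = 0.
  move=> x0 y1; apply: disj; last exact: E_mul.
  (* On x y both D and [ad e0] reduce to left multiplication by e0, and e0 (x y) is again a product
     of [E 0] by [E 1]. *)
  suff iterE n : iter n D (mul x y) = iter n (ad e0) (mul x y).
    by exists N; rewrite /gen_eigen scale0r subr0 iterE ad_nil.
  elim: n x y x0 y1 => // n IHn x y x0 y1; rewrite !iterSr.
  have xy1 := E_mul _ x _ y1.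
  rewrite adE DE (mul101 _ _ e1) // addr0 /commutator (mul10 e0) // subr0.
  exact: IHn.
have cent1 w : E 1 w -> lie_central br w.
  move=> w1 y; have [u [v [-> u0 v1]]] := decomp y.
  rewrite linearDr /= (br11 w v) ?addr0 //; last by exists N.
  by rewrite /commutator mul10 ?mul01 ?subr0 //; exists N.
(* L_e0 agrees with D on [E 0], which e1 kills, and vanishes on [E 1]; the additional iteration
   serves the latter. *)
have nil0 v : iter N.+1 (lmul e0) v = 0.
  have [u [w [-> u0 w1]]] := decomp v.
  rewrite iter_lfunD [X in _ + X]iterSr lmulE mul01 //; last by exists N.
  rewrite iter_lfun0 addr0.
  suff -> n x : E 0 x -> iter n (lmul e0) x = iter n D x.
  - apply: iter_lfun_le (leqnSn N) _.
    by move: u0; rewrite /gen_eigen scale0r subr0.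
  - by exists N.
  elim: n x => // n IHn x x0; rewrite !iterSr.
  have <- : D x = lmul e0 x by rewrite DE lmulE (mul10 x e1) ?addr0.
  by apply: IHn; rewrite /D lmulE; apply: E_mul.
rewrite /D eE lmulD lftraceD (lftrace_nilpotent nil0) add0r.
exact/lftrace_lmul_derived/centC/cent1.
Qed.

Lemma rmul_nilpotent N a : [pchar F] =i pred0 ->
    C N = 0%VS -> (forall z, lie_central br z -> z \in C 1) ->
  exists j, forall v, iter j (rmul a) v = 0.
Proof.
move=> charF0 CN0 centC; have /pcharf0P natF0 := charF0.
have [k [c [P [PE PP [r [trP nilr]]]]]] := lfun_fitting_idempotent (rmul a).
(* By [lowers_lmul_iter], the summand [iter i (rmul a) a] accounts for [iter i.+1 (rmul a)] in P. *)
pose e := \sum_(i < k) c i *: iter i (rmul a) a.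
have lowP : lowers (lmul e - P).
  move=> j v Cv; rewrite add_lfunE opp_lfunE lmulE PE /e linear_sumlz -sumrB.
  apply: memv_suml => i _; rewrite linearZl_LR /= -scalerBr memvZ //.
  exact: lowers_lmul_iter.
have CP j v : v \in C j -> P v \in C j.
  move=> Cv; rewrite PE memv_suml // => i _; rewrite memvZ //.
  by elim: i.+1 => //= n IHn; rewrite rmulE lower_central_rmul.
(* In characteristic zero the rank r vanishes once the trace of P does. *)
apply: nilr; apply/eqP; rewrite -natF0 -trP.
have -> : P = lmul e + (-1) *: (lmul e - P).
  by rewrite scaleN1r opprB addrC subrK.
rewrite lftraceD lftraceZ (lftrace_nilpotent (lowers_nilpotent CN0 lowP)).
rewrite mulr0 addr0 (lftrace_lmul_idempotent CN0) //; first by rewrite natF0.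
move=> j v Cv; rewrite add_lfunE opp_lfunE comp_lfunE.
(* As P^2 = P, L_e^2 - L_e = L_e nu + nu P - nu. *)
pose nu := lmul e - P; have LE u : lmul e u = nu u + P u.
  by rewrite add_lfunE opp_lfunE subrK.
rewrite {1}[lmul e v]LE linearD /= [lmul e (P v)]LE PP [X in _ - X]LE.
rewrite opprD addrACA -!addrA [P v + _]addrC addrA.
rewrite addNr addr0 memvD ?memvB ?lowP ?CP //.
by rewrite lmulE; apply: (@lower_central_lmul j.+1); apply: lowP.
Qed.

End DerivationAlgebra.

Theorem corollary25 (F : fieldType) (charF0 : [pchar F] =i pred0)
  (A : vectType F) (mul : {bilinear A -> A -> A}) :
  derivation_algebra mul ->
  nonsingular_nilpotent (commutator mul) ->
  complete mul.
Proof.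
move=> derA [[|m] [// _ _ Cm0 centE]] x.
have [|j nilj] := rmul_nilpotent derA x charF0 Cm0.
  (* The centre is a term of positive index of the lower central series, so it lies in [A, A]. *)
  move=> z /centE; elim: m {Cm0 centE} => // m IHm zC.
  exact/IHm/(@lower_centralS _ _ _ m.+1).
by exists j => y; rewrite -[RHS](nilj y); apply: eq_iter => u; rewrite rmulE.
Qed.
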